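(* Let $t\in[-1,1]$, let $\mathcal{B}_t$ be the set of all bivariate copulas $C$ with Blomqvist's beta $\beta(C)=t$, and let $\underline{B}_t=\inf\mathcal{B}_t$ and $\overline{B}_t=\sup\mathcal{B}_t$ be its pointwise infimum and supremum. Then Gini's gamma satisfies (a) $\gamma(\underline{B}_t)=\dfrac{3(1+t)^2}{8}-1$, and (b) $\gamma(\overline{B}_t)=1-\dfrac{3(1-t)^2}{8}$.
   Context: A bivariate copula is a function $C:[0,1]^2\to[0,1]$ with $C(u,0)=C(0,v)=0$, $C(u,1)=u$, $C(1,v)=v$, that is 2-increasing. $\mathcal{C}$ denotes the set of all bivariate copulas. Blomqvist's beta: $\beta(C)=4C\left(\tfrac12,\tfrac12\right)-1$. Concordance function: for copulas $C_1,C_2$, $\mathcal{Q}(C_1,C_2)=4\int_{[0,1]^2}C_2(u,v)\,dC_1(u,v)-1$, where $dC_1$ denotes integration with respect to the probability measure on $[0,1]^2$ with distribution function $C_1$. Gini's gamma: $\gamma(C)=\mathcal{Q}(C,M)+\mathcal{Q}(C,W)$, where $M(u,v)=\min\{u,v\}$ and $W(u,v)=\max\{0,u+v-1\}$. $\mathcal{B}_t=\{C\in\mathcal{C}:\beta(C)=t\}$; $\underline{B}_t(u,v)=\inf_{C\in\mathcal{B}_t}C(u,v)$ and $\overline{B}_t(u,v)=\sup_{C\in\mathcal{B}_t}C(u,v)$ for all $(u,v)\in[0,1]^2$. These two functions are known to be copulas. *)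

(* Defs.v *)
From mathcomp Require Import all_boot all_order all_algebra.
From mathcomp Require Import all_classical all_reals all_analysis.

Set Implicit Arguments.
Unset Strict Implicit.
Unset Printing Implicit Defensive.

Import Order.TTheory GRing.Theory Num.Theory.
Import numFieldNormedType.Exports.

Local Open Scope classical_set_scope.
Local Open Scope ring_scope.

Definition unit_square (R : realType) : set (R * R) := `[0, 1] `*` `[0, 1].

(* A function on [0,1]^2 is encoded as a total C : R -> R -> R of which only
   the values on [0,1]^2 matter. *)
Record is_copula (R : realType) (C : R -> R -> R) : Prop := IsCopula {
  copula_range : forall u v, 0 <= u <= 1 -> 0 <= v <= 1 -> 0 <= C u v <= 1 ;
  copula_u0 : forall u, 0 <= u <= 1 -> C u 0 = 0 ;
  copula_0v : forall v, 0 <= v <= 1 -> C 0 v = 0 ;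
  copula_u1 : forall u, 0 <= u <= 1 -> C u 1 = u ;
  copula_1v : forall v, 0 <= v <= 1 -> C 1 v = v ;
  copula_2incr : forall u1 u2 v1 v2,
    0 <= u1 -> u1 <= u2 -> u2 <= 1 -> 0 <= v1 -> v1 <= v2 -> v2 <= 1 ->
    0 <= C u2 v2 - C u2 v1 - C u1 v2 + C u1 v1 }.

Definition blomqvist_beta (R : realType) (C : R -> R -> R) : R :=
  4 * C (1 / 2) (1 / 2) - 1.

(* For a copula C, taking u = v = 1 shows that mu gives mass 1 to [0,1]^2, so
   that mu is a probability measure on the unit square. *)
Definition has_distribution_function (R : realType) (C : R -> R -> R)
    (mu : probability (measurableTypeR R * measurableTypeR R)%type R) : Prop :=
  forall u v : R, 0 <= u <= 1 -> 0 <= v <= 1 ->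
    mu (`[0, u] `*` `[0, v]) = (C u v)%:E.

(* The measure dC; it exists and is unique for every copula C, and the Dirac
   default is only used when C is not the distribution function of a
   probability measure on the unit square. *)
Definition copula_measure (R : realType) (C : R -> R -> R) :
    probability (measurableTypeR R * measurableTypeR R)%type R :=
  xget (dirac ((0, 0) : measurableTypeR R * measurableTypeR R)%type
      : probability (measurableTypeR R * measurableTypeR R)%type R)
    [set mu | has_distribution_function C mu].

Definition concordance (R : realType) (C1 C2 : R -> R -> R) : R :=
  4 * (\int[copula_measure C1]_(p in @unit_square R) C2 p.1 p.2) - 1.

Definition copula_M (R : realType) (u v : R) : R := Num.min u v.

Definition copula_W (R : realType) (u v : R) : R := Num.max 0 (u + v - 1).

Definition gini_gamma (R : realType) (C : R -> R -> R) : R :=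
  concordance C (@copula_M R) + concordance C (@copula_W R).

Definition beta_class (R : realType) (t : R) : set (R -> R -> R) :=
  [set C | is_copula C /\ blomqvist_beta C = t].

Definition B_lower (R : realType) (t u v : R) : R :=
  inf [set C u v | C in beta_class t].

Definition B_upper (R : realType) (t u v : R) : R :=
  sup [set C u v | C in beta_class t].

(* Main.v *)
Require Import Defs.
From mathcomp Require Import all_boot all_order all_algebra.
From mathcomp Require Import all_classical all_reals all_analysis.
From mathcomp Require Import measurable_realfun ring lra.
Import Order.TTheory GRing.Theory Num.Theory.
Import numFieldNormedType.Exports.
Local Open Scope classical_set_scope.
Local Open Scope ring_scope.

Set Implicit Arguments.
Unset Strict Implicit.
Unset Printing Implicit Defensive.

(* With c = C(1/2, 1/2) = (1 + t) / 4, monotonicity and the Lipschitz property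
   of copulas give, writing z^+ for max(0, z),
     max(0, u + v - 1, c - (1/2 - u)^+ - (1/2 - v)^+) <= C(u, v)
       <= min(u, v, c + (u - 1/2)^+ + (v - 1/2)^+).
   Both bounds are shuffles of M: each is the distribution function of the
   Lebesgue measure carried by four segments of slope -1 (resp. +1).  So both
   bounds are copulas of the class, hence its pointwise infimum and supremum.
   By the layer cake formula and Tonelli's theorem, for every measure dC with
   distribution function C,
     \int M dC = \int_0^1 (1 - 2x + C(x, x)) dx  and
     \int W dC = \int_0^1 C(1 - x, x) dx,
   and for the two bounds these integrands are piecewise linear, that is,
   combinations of functions (x - a)^+. *)

(** * Piecewise linear case analysis *)

(** Forces innermost [min] and [max] to be resolved first, so that every comparison passed to [lra]
    is linear. *)
Ltac no_minmax x := lazymatch x with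
  | context [Order.max _ _] => fail
  | context [Order.min _ _] => fail
  | _ => idtac
  end.

(* Case splits are only made on comparisons that the context leaves open. *)
Ltac minmax_split x y :=
  no_minmax x; no_minmax y;
  let H := fresh in
  first [ (have H : x <= y by lra); rewrite ?(max_r H) ?(min_l H); clear H
        | (have H : y <= x by lra); rewrite ?(max_l H) ?(min_r H); clear H
        | case: (lerP x y) => ? ].

Ltac minmax_lra :=
  repeat match goal with
  | |- context [Order.max ?x ?y] => minmax_split x y
  | |- context [Order.min ?x ?y] => minmax_split x y
  end; lra.

(** Serves both as the positive part of x - a and as the length of the possibly empty interval
    [a, x]. *)
Definition hinge (R : realDomainType) (a x : R) : R := Num.max 0 (x - a).

Lemma hinge_eq0 (R : realDomainType) (a x : R) : x <= a -> hinge a x = 0.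
Proof. by move=> xa; rewrite /hinge max_l// subr_le0. Qed.

Lemma hinge_id (R : realDomainType) (a x : R) : a <= x -> hinge a x = x - a.
Proof. by move=> xa; rewrite /hinge max_r// subr_ge0. Qed.

Definition lower_bound_copula (R : realFieldType) (c u v : R) : R :=
  Num.max (Num.max 0 (u + v - 1)) (c - hinge u (1/2) - hinge v (1/2)).

Definition upper_bound_copula (R : realFieldType) (c u v : R) : R :=
  Num.min (Num.min u v) (c + hinge (1/2) u + hinge (1/2) v).

(** * Mass that the segments put on a box anchored at the origin *)

(** A segment y = r - x over [p, q] meets [0, u] x [0, v] for x between max(p, r - v) and min(q, u);
    each summand is the length of this interval. The four quadrants around (1/2, 1/2) are treated
    separately. *)
Lemma lower_segments_mass (R : realFieldType) (c u v : R) :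
  0 <= c <= 1/2 -> 0 <= u <= 1 -> 0 <= v <= 1 ->
  hinge (Num.max 0 (1-v)) (Num.min (1/2-c) u)
  + hinge (Num.max (1/2-c) (1-c-v)) (Num.min (1/2) u)
  + hinge (Num.max (1/2) (1+c-v)) (Num.min (1/2+c) u)
  + hinge (Num.max (1/2+c) (1-v)) (Num.min 1 u) = lower_bound_copula c u v.
Proof.
rewrite /lower_bound_copula => /andP[c0 c2] /andP[u0 u1] /andP[v0 v1].
rewrite (max_r (_ : 0 <= 1 - v)) ?subr_ge0// (min_r u1).
case: (lerP u (1/2)) => hu; case: (lerP v (1/2)) => hv.
(* For u, v <= 1/2 only the second segment can meet the box. *)
- rewrite (max_r (_ : 1 / 2 - c <= 1 - c - v)); last by lra.
  rewrite (@hinge_eq0 _ (1 - v)); last by rewrite ge_min; apply/orP; left; lra.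
  rewrite (@hinge_eq0 _ _ (Num.min (1/2+c) u)); last by rewrite ge_min !le_max hu !orbT.
  rewrite (@hinge_eq0 _ (Num.max (1/2+c) _)); last by rewrite le_max; apply/orP; left; lra.
  rewrite [hinge u _]hinge_id// [hinge v _]hinge_id// (max_l (_ : u + v - 1 <= 0)); last lra.
  by rewrite /hinge add0r !addr0; congr Num.max; lra.
- rewrite (max_l (_ : 1 - c - v <= 1 / 2 - c)); last by lra.
  rewrite (@hinge_eq0 _ _ (Num.min (1/2+c) u)); last by rewrite ge_min !le_max hu !orbT.
  rewrite (@hinge_eq0 _ (Num.max (1/2+c) _)); last by rewrite le_max; apply/orP; left; lra.
  rewrite [hinge u _]hinge_id// [hinge v _]hinge_eq0 ?ltW//.
  rewrite /hinge !addr0 subr0.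
  case: (lerP (1/2-c) u) => ?.
    by rewrite [X in _ + X]max_r; [minmax_lra|lra].
  by rewrite [X in _ + X]max_l; [minmax_lra|lra].
- rewrite (max_r (_ : 1 / 2 - c <= 1 - c - v)); last by lra.
  rewrite (@hinge_eq0 _ (1 - v)); last by rewrite ge_min; apply/orP; left; lra.
  rewrite (@hinge_eq0 _ _ (Num.min (1/2+c) u)); last first.
    by rewrite ge_min le_max; apply/orP; left; apply/orP; right; lra.
  rewrite [hinge v _]hinge_id// [hinge u _]hinge_eq0 ?ltW//.
  rewrite /hinge addr0 add0r.
  case: (lerP (1/2+c) (1-v)) => hv'.
    rewrite (max_l (_ : 1 / 2 - (1 - c - v) <= 0)); last lra.
    rewrite [RHS]max_l; last by rewrite le_max; apply/orP; left; lra.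
    by minmax_lra.
  rewrite (max_r (_ : 0 <= 1 / 2 - (1 - c - v))); last lra.
  by case: (lerP (1/2+c) u) => hu'; [rewrite max_r; [minmax_lra|lra]|
     rewrite max_l; [minmax_lra|lra]].
(* For u, v > 1/2 the second segment counts in full, with mass c; the position of u and v relative
   to 1/2 + c decides how the others are cut. *)
- rewrite (max_l (_ : 1 - c - v <= 1 / 2 - c)); last by lra.
  rewrite (max_l (_ : 1 - v <= 1 / 2 + c)); last by lra.
  rewrite (min_l (_ : 1 / 2 - c <= u)); last by lra.
  rewrite [hinge v _]hinge_eq0 ?ltW// [hinge u _]hinge_eq0 ?ltW//.
  rewrite (@hinge_id _ (1/2-c)); last lra.
  rewrite (max_r (_ : 0 <= u + v - 1)); last lra.
  case: (lerP (1/2+c) u) => hu'; case: (lerP (1/2) (1+c-v)) => hv'.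
  + rewrite (@hinge_eq0 _ (1 - v)) ?(@hinge_id _ (1 + c - v)) ?(@hinge_id _ _ u) ?max_l; lra.
  + rewrite (@hinge_id _ (1 - v)) ?(@hinge_id _ (1/2)) ?(@hinge_id _ _ u) ?max_l; lra.
  + rewrite (@hinge_eq0 _ (1 - v)) ?(@hinge_eq0 _ (1/2+c)) /hinge; [minmax_lra|lra..].
  + rewrite (@hinge_id _ (1 - v)) ?(@hinge_eq0 _ (1/2+c)) ?(@hinge_id _ _ u) ?max_l; lra.
Qed.

(** Here a segment y = x + r over [p, q] meets the box for x between p and min(q, u, v - r). *)
Lemma upper_segments_mass (R : realFieldType) (c u v : R) :
  0 <= c <= 1/2 -> 0 <= u <= 1 -> 0 <= v <= 1 ->
  hinge 0 (Num.min (Num.min c u) v)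
  + hinge c (Num.min (Num.min (1/2) u) (v - (1/2-c)))
  + hinge (1/2) (Num.min (Num.min (1-c) u) (v + (1/2-c)))
  + hinge (1-c) (Num.min (Num.min 1 u) v) = upper_bound_copula c u v.
Proof.
rewrite /upper_bound_copula => /andP[c0 c2] /andP[u0 u1] /andP[v0 v1].
rewrite (min_r u1) (@hinge_id _ 0) ?subr0; last by rewrite !le_min c0 u0 v0.
case: (lerP u (1/2)) => hu; case: (lerP v (1/2)) => hv.
- rewrite (@hinge_eq0 _ c) ?(@hinge_eq0 _ (1/2)) ?(@hinge_eq0 _ (1-c)) ?addr0 //.
  + by rewrite [RHS]minC minA.
  + by rewrite ge_min; apply/orP; left; lra.
  + by rewrite !ge_min hu orbT.
  + by rewrite ge_min; apply/orP; right; lra.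
- rewrite (@hinge_eq0 _ (1/2) (Num.min _ _)) ?(@hinge_eq0 _ (1-c))
    ?(@hinge_eq0 _ _ u)//; last first.
  + by rewrite !ge_min hu !orbT.
  + by rewrite ge_min; apply/orP; left; lra.
  rewrite (min_l (_ : Num.min c u <= v)); last by rewrite ge_min; apply/orP; left; lra.
  rewrite (min_l (_ : u <= v)); last lra.
  rewrite [hinge _ v]hinge_id ?ltW// !addr0 /hinge.
  by case: (lerP c u) => ?; minmax_lra.
- rewrite (@hinge_eq0 _ c) ?(@hinge_eq0 _ (1-c)) ?(@hinge_eq0 _ _ v)//; last first.
  + by rewrite !ge_min; apply/orP; right; lra.
  + by rewrite !ge_min; apply/orP; right; lra.
  rewrite (min_l (_ : c <= u)); last lra.
  rewrite (min_r (_ : v <= u)); last lra.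
  rewrite [hinge _ u]hinge_id ?ltW// !addr0.
  case: (lerP c v) => hv'; last first.
    rewrite hinge_eq0; last by rewrite ge_min; apply/orP; right; lra.
    by rewrite addr0 min_l//; lra.
  rewrite minAC (min_r (_ : v + (1/2-c) <= 1 - c)); last lra.
  by rewrite hinge_id; [minmax_lra|rewrite le_min; lra].
- rewrite (min_l (_ : c <= u)); last lra.
  rewrite (min_l (_ : c <= v)); last lra.
  rewrite [hinge _ u]hinge_id ?ltW// [hinge _ v]hinge_id ?ltW//.
  rewrite (min_l (_ : Num.min (1-c) u <= _)); last by rewrite ge_min; apply/orP; left; lra.
  case: (lerP (1-c) u) => hu'; case: (lerP (1/2) (v - (1/2-c))) => hv'.
  (* When u, v >= 1 - c, the third term of the bound, u + v - 1 + c, exceeds the first two or equals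
     one of them, so the minimum is min(u, v). *)
  + have ? : Num.min u v <= u + v - 1 + c by rewrite ge_min; apply/orP; left; lra.
    rewrite !hinge_id ?le_min; try lra.
    by rewrite [RHS]min_l; lra.
  + rewrite (min_r (_ : v <= u)); last lra.
    by rewrite (@hinge_eq0 _ (1 - c)) ?hinge_id ?[RHS]min_l; lra.
  + rewrite (min_l (_ : u <= v)); last lra.
    by rewrite (@hinge_eq0 _ (1 - c)) ?hinge_id ?[RHS]min_l; lra.
  + rewrite (@hinge_eq0 _ (1 - c)); last by rewrite ge_min; apply/orP; left; lra.
    by rewrite !hinge_id ?[RHS]min_r ?le_min; lra.
Qed.

(** * Distribution functions and copulas *)

(** Inclusion-exclusion over closed boxes anchored at the origin; the rectangle is half-open because
    it arises by removing two such boxes from a third. *)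
Lemma distribution_rectangle (R : realType) (C : R -> R -> R)
    (mu : probability (measurableTypeR R * measurableTypeR R)%type R)
    (u1 u2 v1 v2 : R) :
  has_distribution_function C mu ->
  0 <= u1 -> u1 <= u2 -> u2 <= 1 -> 0 <= v1 -> v1 <= v2 -> v2 <= 1 ->
  mu (`]u1, u2] `*` `]v1, v2]) = (C u2 v2 - C u2 v1 - C u1 v2 + C u1 v1)%:E.
Proof.
move=> muC u10 u12 u21 v10 v12 v21.
have m u v : measurable (`[0, u]%classic `*` `[0, v]%classic
    : set (measurableTypeR R * measurableTypeR R)).
  by apply: measurableX; exact: measurable_itv.
have -> : `]u1, u2] `*` `]v1, v2] =
    (`[0, u2] `*` `[0, v2]) `\` ((`[0, u1] `*` `[0, v2]) `|` (`[0, u2] `*` `[0, v1])).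
  apply/seteqP; split=> -[x y] /=; rewrite !in_itv /=.
    move=> [/andP[? ?] /andP[? ?]]; split; first by split; lra.
    by move=> [[]|[]]; lra.
  move=> [[/andP[x0 xu] /andP[y0 yv]] H]; split.
    rewrite xu andbT ltNge; apply/negP => xu1; apply: H; left.
    by rewrite x0 xu1 y0 yv.
  rewrite yv andbT ltNge; apply/negP => yv1; apply: H; right.
  by rewrite x0 xu y0 yv1.
pose B0 : set (measurableTypeR R * measurableTypeR R) := `[0, u2] `*` `[0, v2].
pose B1 : set (measurableTypeR R * measurableTypeR R) := `[0, u1] `*` `[0, v2].
pose B2 : set (measurableTypeR R * measurableTypeR R) := `[0, u2] `*` `[0, v1].
have BI : B1 `&` B2 = `[0, u1] `*` `[0, v1].
  apply/seteqP; split=> -[x y] /=; rewrite /B1 /B2 /= !in_itv /=.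
    by move=> [[? ?] [? ?]]; split; lra.
  by move=> [? ?]; split; split; lra.
have muU : mu (B1 `|` B2) = (C u1 v2 + C u2 v1 - C u1 v1)%:E.
  transitivity (mu B1 + mu B2 - mu (B1 `&` B2))%E.
    by apply: measureUfinl; rewrite ?(le_lt_trans (probability_le1 _ _) (ltry _))//; exact: m.
  by rewrite BI !muC -?EFinD -?EFinN -?EFinD; [congr EFin|..]; lra.
transitivity (mu B0 - mu (B0 `&` (B1 `|` B2)))%E.
  apply: measureD; rewrite ?(le_lt_trans (probability_le1 _ _) (ltry _))//; try exact: m.
  by apply: measurableU; exact: m.
rewrite setIidr ?muU ?muC -?EFinB; [congr EFin; lra|lra|lra|].
by move=> [x y] [] []; rewrite /B0 /= !in_itv /= => *; split; lra.
Qed.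

(** Being 2-increasing is the nonnegativity of the mass of rectangles, so a copula only has its
    boundary values left to check. *)
Lemma distribution_is_copula (R : realType) (C : R -> R -> R)
    (mu : probability (measurableTypeR R * measurableTypeR R)%type R) :
  has_distribution_function C mu ->
  (forall u, 0 <= u <= 1 -> C u 0 = 0) ->
  (forall v, 0 <= v <= 1 -> C 0 v = 0) ->
  (forall u, 0 <= u <= 1 -> C u 1 = u) ->
  (forall v, 0 <= v <= 1 -> C 1 v = v) -> is_copula C.
Proof.
move=> muC Cu0 C0v Cu1 C1v; split => //.
  move=> u v u01 v01; rewrite -!lee_fin -muC// measure_ge0 probability_le1//.
  by apply: measurableX; exact: measurable_itv.
by move=> u1 u2 v1 v2 *; rewrite -lee_fin -(@distribution_rectangle _ _ mu)//.
Qed.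

(** * Layer cake formula *)

(** The integrand [g] is the length of a set of levels x; exchanging integrals leaves the mass of
    ]a(x), 1] x ]x, 1]. A general [a] covers both M (a(x) = x) and W (a(x) = 1 - x). *)
Lemma integral_layer_cake (R : realType) (C : R -> R -> R)
    (mu : probability (measurableTypeR R * measurableTypeR R)%type R)
    (a : R -> R) (g : R * R -> R) :
  is_copula C -> has_distribution_function C mu ->
  measurable_fun [set: measurableTypeR R] (a : measurableTypeR R -> R) ->
  (forall x, 0 <= x <= 1 -> 0 <= a x <= 1) ->
  (forall p, @unit_square R p -> lebesgue_measure
    [set x | 0 <= x <= 1 /\ a x < p.1 /\ x < p.2] = (g p)%:E) ->
  \int[mu]_(p in @unit_square R) g p =
  \int[lebesgue_measure]_(x in `[0, 1]) (1 - a x - x + C (a x) x).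
Proof.
(* Equality is proved between extended real integrals, where Tonelli's theorem applies to indicators
   without integrability conditions. *)
move=> copC muC ma a01 gE; congr fine.
(* [A] includes the unit cube constraints, so its sections vanish off the domains and both integrals
   extend to the whole space. *)
pose A : set ((measurableTypeR R * measurableTypeR R) * measurableTypeR R) :=
  [set q | (0 <= q.1.1 <= 1) && (0 <= q.1.2 <= 1) && (0 <= q.2 <= 1) &&
           (a q.2 < q.1.1) && (q.2 < q.1.2)].
have mA : measurable A.
  have m1 : measurable_fun setT (fun q : (measurableTypeR R * measurableTypeR R)
      * measurableTypeR R => q.1.1 : R) by exact: measurableT_comp.
  have m2 : measurable_fun setT (fun q : (measurableTypeR R * measurableTypeR R)
      * measurableTypeR R => q.1.2 : R) by exact: measurableT_comp.
  have m3 : measurable_fun setT (fun q : (measurableTypeR R * measurableTypeR R)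
      * measurableTypeR R => q.2 : R) by exact: measurable_snd.
  have m4 : measurable_fun setT (fun q : (measurableTypeR R * measurableTypeR R)
      * measurableTypeR R => a q.2 : R) by exact: (measurableT_comp ma).
  have : measurable_fun setT (fun q : (measurableTypeR R * measurableTypeR R)
      * measurableTypeR R =>
      (0 <= q.1.1 <= 1) && (0 <= q.1.2 <= 1) && (0 <= q.2 <= 1) &&
           (a q.2 < q.1.1) && (q.2 < q.1.2)).
    do ?[apply: measurable_and];
      first [apply: measurable_fun_ler|apply: measurable_fun_ltr];
      first [exact: m1|exact: m2|exact: m3|exact: m4|exact: measurable_cst].
  by move=> /(_ measurableT [set true] I); rewrite setTI.
have := @indic_fubini_tonelli _ _ _ _ R mu (@lebesgue_measure R) A mA.
rewrite indic_fubini_tonelli_FE// indic_fubini_tonelli_GE// => mulam.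
transitivity (\int[mu]_p ((lebesgue_measure \o xsection A) p))%E.
  rewrite [LHS]integral_mkcond; apply: eq_integral => p _ /=.
  rewrite patchE; case: ifPn => [/set_mem pU|/negP pU].
    rewrite -gE//; congr lebesgue_measure; apply/seteqP; split => x /=.
      move=> [x01 [axp xp]]; apply/mem_set; rewrite /A/= axp xp x01.
      by case: p pU axp xp => p1 p2 [] /=; rewrite !in_itv/= => -> ->.
    by move/set_mem; rewrite /A/= => /andP[/andP[/andP[_ ->] ->] ->].
  rewrite (_ : xsection A p = set0) ?measure0//.
  rewrite -subset0 => x /set_mem; rewrite /A/= => H; apply: pU; apply/mem_set.
  by split => /=; rewrite in_itv/=; lra.
rewrite mulam [RHS]integral_mkcond; apply: eq_integral => x _.
rewrite patchE; case: ifPn => [/set_mem/=|].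
  rewrite in_itv/= => x01.
  have ax01 := a01 _ x01.
  have <- : mu (`]a x, 1] `*` `]x, 1]) = (1 - a x - x + C (a x) x)%:E.
    rewrite (@distribution_rectangle _ _ _ (a x) 1 x 1 muC); [|lra..].
    by rewrite !(copula_1v copC) ?(copula_u1 copC) ?ler01 ?lexx//; congr EFin; lra.
  congr (mu _); apply/seteqP; split => -[u v] /=.
    by move=> /set_mem; rewrite /A/= !in_itv/= => ?; split; lra.
  by rewrite !in_itv/= => -[? ?]; apply/mem_set; rewrite /A/=; lra.
move=> /negP; rewrite /= => xN /=.
rewrite (_ : ysection A x = set0) ?measure0//.
rewrite -subset0 => p /set_mem; rewrite /A/= => H; apply: xN; apply/mem_set.
by rewrite /= in_itv/=; lra.
Qed.

(** * Integrals of piecewise linear functions *)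

Lemma continuous_hinge (R : realType) (a : R) : continuous (hinge a).
Proof.
move=> x; apply: (@continuous_max _ _ (cst 0) (fun y => y - a)); first exact: cst_continuous.
by apply: continuousB => //; exact: cst_continuous.
Qed.

Lemma integrable_hinge (R : realType) (k a : R) :
  lebesgue_measure.-integrable `[0, 1] (EFin \o (fun x => k * hinge a x)).
Proof.
apply: continuous_compact_integrable; first exact: segment_compact.
apply: continuous_subspaceT => x; apply: continuousM; first exact: cst_continuous.
exact: continuous_hinge.
Qed.

Lemma integral_hinge (R : realType) (a : R) : 0 <= a <= 1 ->
  \int[lebesgue_measure]_(x in `[0, 1]) hinge a x = (1 - a) ^+ 2 / 2.
Proof.
move=> /andP[a0 a1].
have ih : lebesgue_measure.-integrable `[0, 1] (EFin \o hinge a).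
  apply: continuous_compact_integrable; first exact: segment_compact.
  by apply: continuous_subspaceT => x; exact: continuous_hinge.
have := @Rintegral_itvB R (hinge a) (BLeft 0) (BRight 1) a ih.
rewrite !bnd_simp => /(_ a0 a1).
rewrite [X in _ - X](_ : _ = 0) ?subr0 => [->|]; last first.
  rewrite (@eq_Rintegral _ _ _ _ _ (cst 0)) ?Rintegral_cst ?mul0r// => x.
  by rewrite inE /= in_itv /= => /andP[_ xa]; rewrite hinge_eq0.
rewrite Rintegral_itv_obnd_cbnd; last first.
  apply: integrableS ih => //.
  by move=> x /=; rewrite !in_itv /=; lra.
(* The fundamental theorem of calculus requires a < 1; for a = 1 the remaining interval is a
   point. *)
move: a1; rewrite le_eqVlt => /predU1P[->|a1].
  by rewrite set_itv1 Rintegral_set1 subrr expr0n mul0r.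
have FTC := @continuous_FTC2 R (hinge a) (fun x => (x - a) ^+ 2 / 2) a 1 a1.
rewrite /Rintegral FTC.
- by rewrite -EFinB /= subrr expr0n /= mul0r subr0.
- by apply: continuous_subspaceT => x; exact: continuous_hinge.
- have dF (x : R) : derivable (fun x : R => (x - a) ^+ 2 / 2) x 1 by [].
  have cF : continuous (fun x : R => (x - a) ^+ 2 / 2).
    by move=> x; apply/differentiable_continuous/derivable1_diffP.
  split=> [x _ //| |].
    exact: cvg_at_right_filter (cF a).
  exact: cvg_at_left_filter (cF 1).
- move=> x; rewrite in_itv /= => /andP[ax _].
  rewrite hinge_id ?ltW// derive1E.
  by rewrite derive_val /GRing.scale /=; field.
Qed.

(** A continuous piecewise linear function is encoded by its value [k] at 0 and a list of pairs
    (change of slope, breakpoint); its integral then becomes a finite sum. *)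
Lemma integral_hinge_sum (R : realType) (f : R -> R) (k : R) (s : seq (R * R)) :
  (forall x, 0 <= x <= 1 -> f x = k + \sum_(p <- s) p.1 * hinge p.2 x) ->
  all (fun p => 0 <= p.2 <= 1) s ->
  \int[lebesgue_measure]_(x in `[0, 1]) f x =
  k + \sum_(p <- s) p.1 * ((1 - p.2) ^+ 2 / 2).
Proof.
move=> fE s01; transitivity (\int[lebesgue_measure]_(x in `[0, 1])
    (k + \sum_(p <- s) p.1 * hinge p.2 x)).
  by apply: eq_Rintegral => x /set_mem /=; rewrite in_itv /=; exact: fE.
have icst : lebesgue_measure.-integrable `[0, 1]
    (EFin \o (fun _ : measurableTypeR R => k)).
  apply: continuous_compact_integrable; first exact: segment_compact.
  by apply: continuous_subspaceT => x; exact: cst_continuous.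
have isum s' : lebesgue_measure.-integrable `[0, 1]
    (EFin \o (fun x : measurableTypeR R => \sum_(p <- s') p.1 * hinge p.2 x)).
  elim: s' => [|p s' IH].
    rewrite (_ : _ \o _ = cst 0%E); first exact: integrable0.
    by apply/funext => x /=; rewrite big_nil.
  pose h x := p.1 * hinge p.2 x; pose g x := \sum_(p <- s') p.1 * hinge p.2 x.
  rewrite (_ : _ \o _ = ((EFin \o h) \+ (EFin \o g))%E).
    by apply: integrableD => //; exact: integrable_hinge.
  by apply/funext => x /=; rewrite big_cons EFinD.
rewrite RintegralD// Rintegral_cst//.
have -> : fine (lebesgue_measure `[0%R : R, 1%R]) = 1.
  by rewrite lebesgue_measure_itv /= lte_fin ltr01 /= subr0.
rewrite mulr1; congr (_ + _).
elim: s s01 {fE} => [_|p s IH /= /andP[p01 s01]].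
  rewrite (@eq_Rintegral _ _ _ _ _ (cst 0)) ?Rintegral_cst ?mul0r ?big_nil// => x.
  by rewrite big_nil.
transitivity (\int[lebesgue_measure]_(x in `[0, 1])
    (p.1 * hinge p.2 x + \sum_(q <- s) q.1 * hinge q.2 x)).
  by apply: eq_Rintegral => x _; rewrite big_cons.
have ih : lebesgue_measure.-integrable `[0, 1] (EFin \o hinge p.2).
  have := integrable_hinge 1 p.2.
  by under [X in EFin \o X]eq_fun do rewrite mul1r.
by rewrite RintegralD ?RintegralZl ?integral_hinge ?IH ?big_cons//; exact: integrable_hinge.
Qed.

(** * Measures carried by graphs *)

(** The measure is the sum of the images of Lebesgue measure on [a_i, b_i] under x -> (x,
    f_i(x)). *)
Lemma graph_mixture (R : realType) (n : nat) (a b : nat -> R) (f : nat -> R -> R) :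
  (forall i, measurable_fun [set: measurableTypeR R]
    (f i : measurableTypeR R -> measurableTypeR R)) ->
  (forall i, a i <= b i) -> \sum_(i < n) (b i - a i) = 1 ->
  exists mu : probability (measurableTypeR R * measurableTypeR R)%type R,
    forall A, mu A = (\sum_(i < n)
      lebesgue_measure ([set x | A (x, f i x)] `&` `[a i, b i]))%E.
Proof.
move=> mf ab ab1.
have mg i : measurable_fun [set: measurableTypeR R]
    (fun x => (x, f i x) : measurableTypeR R * measurableTypeR R).
  exact: measurable_fun_pair.
have mrestrE i : exists m : {measure set (measurableTypeR R * measurableTypeR R) -> \bar R},
    forall A, m A = lebesgue_measure ([set x | A (x, f i x)] `&` `[a i, b i]).
  unshelve eexists (pushforward (mrestr lebesgue_measure (measurable_itv `[a i, b i]))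
    (fun x => (x, f i x) : measurableTypeR R * measurableTypeR R)); first exact: mg.
  by [].
have [m mE] := choice mrestrE.
have m1 : msum m n [set: measurableTypeR R * measurableTypeR R] = 1%E.
  rewrite /msum (eq_bigr (fun i : 'I_n => (b i - a i)%:E)); last first.
    move=> i _; rewrite mE [X in X `&` _](_ : _ = setT) ?setTI; last exact/seteqP.
    rewrite lebesgue_measure_itv /= lte_fin; case: ltrP => // ba.
    by rewrite (_ : b i = a i) ?subrr//; apply/eqP; rewrite eq_le ba ab.
  by rewrite sumEFin ab1.
(* The total mass is already 1: normalising only supplies the probability structure and changes no
   value. *)
exists (mnormalize (msum m n) (dirac point)) => A.
rewrite /=; set M := (X in mnormalize X); rewrite /mnormalize.
have -> : M setT = 1%E by exact: m1.
by rewrite onee_eq0 /= invr1 mule1; apply: eq_bigr => i _; rewrite mE.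
Qed.

(** * Pointwise bounds for copulas with a prescribed value at (1/2, 1/2) *)

(** Combines two facts: the rectangle [u, x] x [v, 1] gives the Lipschitz bound when u <= x, and
    [x, u] x [0, v] gives monotonicity when x < u. *)
Lemma copula_lipschitz_l (R : realType) (C : R -> R -> R) (u x v : R) :
  is_copula C -> 0 <= u <= 1 -> 0 <= x <= 1 -> 0 <= v <= 1 ->
  C x v <= C u v + hinge u x.
Proof.
move=> copC u01 x01 v01; have [/andP[u0 u1] /andP[x0 x1]] := (u01, x01).
have /andP[v0 v1] := v01.
case: (lerP u x) => ux.
  have := copula_2incr copC u0 ux x1 v0 v1 (lexx (1 : R)).
  by rewrite hinge_id// (copula_u1 copC u01) (copula_u1 copC x01); lra.
have := copula_2incr copC x0 (ltW ux) u1 (lexx (0 : R)) v0 v1.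
by rewrite (hinge_eq0 (ltW ux)) (copula_u0 copC u01) (copula_u0 copC x01); lra.
Qed.

Lemma copula_lipschitz_r (R : realType) (C : R -> R -> R) (u v y : R) :
  is_copula C -> 0 <= u <= 1 -> 0 <= v <= 1 -> 0 <= y <= 1 ->
  C u y <= C u v + hinge v y.
Proof.
move=> copC u01 v01 y01; have [/andP[v0 v1] /andP[y0 y1]] := (v01, y01).
have /andP[u0 u1] := u01.
case: (lerP v y) => vy.
  have := copula_2incr copC u0 u1 (lexx (1 : R)) v0 vy y1.
  by rewrite hinge_id// (copula_1v copC v01) (copula_1v copC y01); lra.
have := copula_2incr copC (lexx (0 : R)) u0 u1 y0 (ltW vy) v1.
by rewrite (hinge_eq0 (ltW vy)) (copula_0v copC v01) (copula_0v copC y01); lra.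
Qed.

Lemma copula_beta_bounds (R : realType) (C : R -> R -> R) (u v : R) :
  is_copula C -> 0 <= u <= 1 -> 0 <= v <= 1 ->
  lower_bound_copula (C (1/2) (1/2)) u v <= C u v
    <= upper_bound_copula (C (1/2) (1/2)) u v.
Proof.
move=> copC u01 v01.
have h01 : 0 <= (1 / 2 : R) <= 1 by lra.
have l01 : 0 <= (0 : R) <= 1 by lra.
have o01 : 0 <= (1 : R) <= 1 by lra.
(* Each of the six terms but 0 comes from moving one coordinate to 0 or 1, or both to 1/2. *)
apply/andP; split; rewrite ?ge_max ?le_min -?andbA; apply/and3P; split.
- by case/andP: (copula_range copC u01 v01).
- have := copula_lipschitz_l copC u01 o01 v01.
  by rewrite (copula_1v copC)// hinge_id; lra.
- have := copula_lipschitz_l copC u01 h01 v01.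
  have := copula_lipschitz_r copC h01 v01 h01; lra.
- have := copula_lipschitz_l copC l01 u01 v01.
  by rewrite (copula_0v copC)// add0r hinge_id ?subr0//; case/andP: u01.
- have := copula_lipschitz_r copC u01 l01 v01.
  by rewrite (copula_u0 copC)// add0r hinge_id ?subr0//; case/andP: v01.
- have := copula_lipschitz_l copC h01 u01 v01.
  have := copula_lipschitz_r copC h01 h01 v01; lra.
Qed.

(** * The bounds as distribution functions *)

Lemma lebesgue_itv_hinge (R : realType) (x y : R) :
  lebesgue_measure (`[x, y] : set R) = (hinge x y)%:E.
Proof.
rewrite lebesgue_measure_itv /= lte_fin; case: ltrP => xy.
  by rewrite hinge_id ?ltW.
by rewrite hinge_eq0.
Qed.

Lemma lower_distribution (R : realType) (c : R) : 0 <= c <= 1/2 ->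
  exists mu, has_distribution_function (@lower_bound_copula R c) mu.
Proof.
move=> hc.
(* Segment i lies on x + y = s_i over [a_i, b_i]. The outer two lie on the antidiagonal of the unit
   square, the inner two are antidiagonals of [1/2 - c, 1/2]^2 and [1/2, 1/2 + c]^2. *)
pose a := nth 0 [:: 0; 1/2 - c; 1/2; 1/2 + c].
pose b := nth 0 [:: 1/2 - c; 1/2; 1/2 + c; 1].
pose s := nth 0 [:: 1; 1 - c; 1 + c; 1].
have mf i : measurable_fun [set: measurableTypeR R]
    (fun x : measurableTypeR R => s i - x : measurableTypeR R).
  by apply: measurable_funB.
have ab i : a i <= b i.
  by rewrite /a /b; case: i => [|[|[|[|i]]]] /=; rewrite ?nth_nil; lra.
have ab1 : \sum_(i < 4) (b i - a i) = 1.
  by rewrite !big_ord_recl big_ord0 /a /b /=; lra.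
have [mu muE] := graph_mixture mf ab ab1.
exists mu => u v u01 v01.
(* The hypotheses keep the segment in the nonnegative quadrant, so only the sides x = u and y = v of
   the box cut it. *)
have mass (p q r : R) : 0 <= p -> q <= r ->
    lebesgue_measure ([set x | (`[0, u] `*` `[0, v]) (x, r - x)] `&` `[p, q])
    = (hinge (Num.max p (r - v)) (Num.min q u))%:E.
  move=> p0 qr; rewrite -lebesgue_itv_hinge; congr lebesgue_measure.
  apply/seteqP; split => x /=; rewrite !in_itv /= ge_max le_min.
    by move=> [[? ?] ?]; lra.
  by move=> ?; split; [split|]; lra.
rewrite -lower_segments_mass// muE !big_ord_recl big_ord0 /a /b /s /=.
by rewrite !mass -?EFinD; [congr EFin; rewrite addr0 !addrA|lra..].
Qed.

Lemma upper_distribution (R : realType) (c : R) : 0 <= c <= 1/2 ->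
  exists mu, has_distribution_function (@upper_bound_copula R c) mu.
Proof.
move=> hc.
(* Translations by [s] fix [0, c] and [1 - c, 1] and exchange [c, 1/2] with [1/2, 1 - c]. *)
pose a := nth 0 [:: 0; c; 1/2; 1 - c].
pose b := nth 0 [:: c; 1/2; 1 - c; 1].
pose s := nth 0 [:: 0; 1/2 - c; - (1/2 - c); 0].
have mf i : measurable_fun [set: measurableTypeR R]
    (fun x : measurableTypeR R => x + s i : measurableTypeR R).
  by apply: measurable_funD.
have ab i : a i <= b i.
  by rewrite /a /b; case: i => [|[|[|[|i]]]] /=; rewrite ?nth_nil; lra.
have ab1 : \sum_(i < 4) (b i - a i) = 1.
  by rewrite !big_ord_recl big_ord0 /a /b /=; lra.
have [mu muE] := graph_mixture mf ab ab1.
exists mu => u v u01 v01.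
have mass (p q r : R) : 0 <= p -> 0 <= p + r ->
    lebesgue_measure ([set x | (`[0, u] `*` `[0, v]) (x, x + r)] `&` `[p, q])
    = (hinge p (Num.min (Num.min q u) (v - r)))%:E.
  move=> p0 pr; rewrite -lebesgue_itv_hinge; congr lebesgue_measure.
  apply/seteqP; split => x /=; rewrite !in_itv /= !le_min.
    by move=> [[? ?] ?]; lra.
  by move=> ?; split; [split|]; lra.
rewrite -upper_segments_mass// muE !big_ord_recl big_ord0 /a /b /s /=.
by rewrite !mass -?EFinD; [congr EFin; rewrite !subr0 opprK addr0 -!addrA|lra..].
Qed.

(** * Identification of the infimum and the supremum *)

Lemma B_lowerE (R : realType) (t u v : R) : -1 <= t <= 1 ->
  is_copula (lower_bound_copula ((1 + t) / 4)) ->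
  0 <= u <= 1 -> 0 <= v <= 1 ->
  B_lower t u v = lower_bound_copula ((1 + t) / 4) u v.
Proof.
move=> ht copL u01 v01; pose L := lower_bound_copula ((1 + t) / 4).
(* At (1/2, 1/2) the hinges vanish and the bound equals (1 + t) / 4, so it belongs to the class and
   the infimum is attained. *)
have inB : (beta_class t) L.
  split=> //; rewrite /blomqvist_beta /L /lower_bound_copula !hinge_eq0// !subr0.
  by rewrite (_ : 1 / 2 + 1 / 2 - 1 = 0) ?maxxx ?max_r; lra.
have lb : lbound [set C u v | C in beta_class t] (L u v).
  move=> _ [C [copC Ct] <-]; have /andP[+ _] := copula_beta_bounds copC u01 v01.
  by rewrite (_ : C (1/2) (1/2) = (1 + t) / 4)//; move: Ct; rewrite /blomqvist_beta; lra.
apply/eqP; rewrite eq_le; apply/andP; split.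
  by apply: ge_inf; [exists (L u v)|exists L].
by apply: lb_le_inf => //; exists (L u v), L.
Qed.

Lemma B_upperE (R : realType) (t u v : R) : -1 <= t <= 1 ->
  is_copula (upper_bound_copula ((1 + t) / 4)) ->
  0 <= u <= 1 -> 0 <= v <= 1 ->
  B_upper t u v = upper_bound_copula ((1 + t) / 4) u v.
Proof.
move=> ht copU u01 v01; pose U := upper_bound_copula ((1 + t) / 4).
have inB : (beta_class t) U.
  split=> //; rewrite /blomqvist_beta /U /upper_bound_copula !hinge_eq0// !addr0 minxx.
  by rewrite min_r; lra.
have ub : ubound [set C u v | C in beta_class t] (U u v).
  move=> _ [C [copC Ct] <-]; have /andP[_] := copula_beta_bounds copC u01 v01.
  by rewrite (_ : C (1/2) (1/2) = (1 + t) / 4)//; move: Ct; rewrite /blomqvist_beta; lra.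
apply/eqP; rewrite eq_le; apply/andP; split.
  by apply: ge_sup => //; exists (U u v), U.
by apply: ub_le_sup; [exists (U u v)|exists U].
Qed.

(** * Gini's gamma from the two diagonal sections *)

Lemma has_distribution_copula_measure (R : realType) (C : R -> R -> R) :
  (exists mu, has_distribution_function C mu) ->
  has_distribution_function C (copula_measure C).
Proof. by move=> [mu muC]; apply: xgetPex; exists mu. Qed.

(** The levels below p form [0, min(p1, p2)[ for a(x) = x and ]1 - p1, p2[ for a(x) = 1 - x, of
    lengths M(p) and W(p). *)
Lemma gini_gamma_diagonals (R : realType) (C : R -> R -> R) :
  is_copula C -> (exists mu, has_distribution_function C mu) ->
  gini_gamma C = 4 *
    (\int[lebesgue_measure]_(x in `[0, 1]) (1 - x - x + C x x) +
     \int[lebesgue_measure]_(x in `[0, 1]) (1 - (1 - x) - x + C (1 - x) x)) - 2.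
Proof.
move=> copC /has_distribution_copula_measure muC.
rewrite /gini_gamma /concordance.
rewrite (integral_layer_cake (a := fun x => x) copC muC)//; last first.
  move=> [p1 p2] [] /=; rewrite !in_itv /= => p101 p201.
  rewrite (_ : [set x | _] = `[0, Num.min p1 p2[%classic); last first.
    by apply/seteqP; split=> x /=; rewrite in_itv /= lt_min; lra.
  rewrite lebesgue_measure_itv /= lte_fin /copula_M.
  case: ltrP => [_|m0]; first by rewrite sube0.
  by congr EFin; apply/eqP; rewrite eq_le m0 andbT le_min; lra.
rewrite (integral_layer_cake (a := fun x => 1 - x) copC muC).
- lra.
- by apply: measurable_funB.
- by move=> x; lra.
move=> [p1 p2] [] /=; rewrite !in_itv /= => p101 p201.
rewrite (_ : [set x | _] = `]1 - p1, p2[%classic); last first.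
  by apply/seteqP; split=> x /=; rewrite in_itv /=; lra.
rewrite lebesgue_measure_itv /= lte_fin /copula_W.
case: ltrP => h.
  by rewrite -EFinB max_r; [congr EFin; lra|lra].
by rewrite max_l//; lra.
Qed.

(** On the diagonal the bound is 0, then c - 1 + 2x, then c, then 2x - 1; the pairs record the
    breakpoints, with -2 at 0 for the term -2x. *)
Lemma lower_diagonal (R : realFieldType) (c x : R) : 0 <= c <= 1/2 -> 0 <= x <= 1 ->
  1 - x - x + lower_bound_copula c x x =
  1 + \sum_(p <- [:: (-2, 0); (2, (1-c)/2); (-2, 1/2); (2, (1+c)/2)])
    p.1 * hinge p.2 x.
Proof.
move=> /andP[c0 c2] /andP[x0 x1]; rewrite !big_cons big_nil /lower_bound_copula /=.
by case: (lerP x (1/2)) => hx; rewrite /hinge; minmax_lra.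
Qed.

(** The section is a tent of height c centred at 1/2. *)
Lemma lower_antidiagonal (R : realFieldType) (c x : R) : 0 <= c <= 1/2 -> 0 <= x <= 1 ->
  1 - (1 - x) - x + lower_bound_copula c (1 - x) x =
  0 + \sum_(p <- [:: (1, 1/2-c); (-2, 1/2); (1, 1/2+c)]) p.1 * hinge p.2 x.
Proof.
move=> /andP[c0 c2] /andP[x0 x1]; rewrite !big_cons big_nil /lower_bound_copula /=.
by case: (lerP x (1/2)) => hx; rewrite /hinge; minmax_lra.
Qed.

Lemma upper_diagonal (R : realFieldType) (c x : R) : 0 <= c <= 1/2 -> 0 <= x <= 1 ->
  1 - x - x + upper_bound_copula c x x =
  1 + \sum_(p <- [:: (-1, 0); (-1, c); (2, 1/2); (-1, 1-c)]) p.1 * hinge p.2 x.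
Proof.
move=> /andP[c0 c2] /andP[x0 x1]; rewrite !big_cons big_nil /upper_bound_copula /=.
by case: (lerP x (1/2)) => hx; rewrite /hinge; minmax_lra.
Qed.

(** The section is min(x, 1 - x, c + |x - 1/2|): two peaks, symmetric about a valley of depth c at
    1/2, whence the breakpoints where x or 1 - x meets the third term. *)
Lemma upper_antidiagonal (R : realFieldType) (c x : R) : 0 <= c <= 1/2 -> 0 <= x <= 1 ->
  1 - (1 - x) - x + upper_bound_copula c (1 - x) x =
  0 + \sum_(p <- [:: (1, 0); (-2, (1/2+c)/2); (2, 1/2); (-2, 1-(1/2+c)/2)])
    p.1 * hinge p.2 x.
Proof.
move=> /andP[c0 c2] /andP[x0 x1]; rewrite !big_cons big_nil /upper_bound_copula /=.
by case: (lerP x (1/2)) => hx; rewrite /hinge; minmax_lra.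
Qed.

Lemma lower_boundary (R : realFieldType) (c x : R) : 0 <= c <= 1/2 -> 0 <= x <= 1 ->
  [/\ lower_bound_copula c x 0 = 0, lower_bound_copula c 0 x = 0,
      lower_bound_copula c x 1 = x & lower_bound_copula c 1 x = x].
Proof.
by move=> /andP[c0 c2] /andP[x0 x1]; split;
  rewrite /lower_bound_copula /hinge; minmax_lra.
Qed.

Lemma upper_boundary (R : realFieldType) (c x : R) : 0 <= c <= 1/2 -> 0 <= x <= 1 ->
  [/\ upper_bound_copula c x 0 = 0, upper_bound_copula c 0 x = 0,
      upper_bound_copula c x 1 = x & upper_bound_copula c 1 x = x].
Proof.
by move=> /andP[c0 c2] /andP[x0 x1]; split;
  rewrite /upper_bound_copula /hinge; minmax_lra.
Qed.

(** * Values of Gini's gamma *)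

(** Functions that agree on the unit square have the same candidate measures, hence the same chosen
    one. This transfers the values from the explicit bounds to [B_lower] and [B_upper], identified
    only there. *)
Lemma eq_gini_gamma (R : realType) (C D : R -> R -> R) :
  (forall u v, 0 <= u <= 1 -> 0 <= v <= 1 -> C u v = D u v) ->
  gini_gamma C = gini_gamma D.
Proof.
move=> CD; rewrite /gini_gamma /concordance.
rewrite (_ : copula_measure C = copula_measure D)//; congr xget.
by apply/seteqP; split=> mu muC u v u01 v01; rewrite muC// CD.
Qed.

Lemma lower_is_copula (R : realType) (c : R) : 0 <= c <= 1/2 ->
  is_copula (lower_bound_copula c).
Proof.
move=> hc; have [mu muC] := lower_distribution hc.
by apply: (distribution_is_copula muC) => x x01; case: (lower_boundary hc x01).
Qed.

Lemma upper_is_copula (R : realType) (c : R) : 0 <= c <= 1/2 ->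
  is_copula (upper_bound_copula c).
Proof.
move=> hc; have [mu muC] := upper_distribution hc.
by apply: (distribution_is_copula muC) => x x01; case: (upper_boundary hc x01).
Qed.

Lemma gini_gamma_lower (R : realType) (c : R) : 0 <= c <= 1/2 ->
  gini_gamma (lower_bound_copula c) = 6 * c ^+ 2 - 1.
Proof.
move=> hc.
rewrite gini_gamma_diagonals; [|exact: lower_is_copula|exact: lower_distribution].
rewrite (integral_hinge_sum (fun x => @lower_diagonal _ c x hc)); last by rewrite /=; lra.
rewrite (integral_hinge_sum (fun x => @lower_antidiagonal _ c x hc)); last by rewrite /=; lra.
by rewrite !big_cons !big_nil /=; field.
Qed.

Lemma gini_gamma_upper (R : realType) (c : R) : 0 <= c <= 1/2 ->
  gini_gamma (upper_bound_copula c) = 1 - 6 * (1/2 - c) ^+ 2.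
Proof.
move=> hc.
rewrite gini_gamma_diagonals; [|exact: upper_is_copula|exact: upper_distribution].
rewrite (integral_hinge_sum (fun x => @upper_diagonal _ c x hc)); last by rewrite /=; lra.
rewrite (integral_hinge_sum (fun x => @upper_antidiagonal _ c x hc)); last by rewrite /=; lra.
by rewrite !big_cons !big_nil /=; field.
Qed.

Theorem theorem9 (R : realType) (t : R) (ht : -1 <= t <= 1) :
  gini_gamma (B_lower t) = 3 * (1 + t) ^+ 2 / 8 - 1 /\
  gini_gamma (B_upper t) = 1 - 3 * (1 - t) ^+ 2 / 8.
Proof.
(* This is the value c at (1/2, 1/2) forced by beta = t; correspondingly 1/2 - c = (1 - t) / 4. *)
have hc : 0 <= (1 + t) / 4 <= 1 / 2 by lra.
split.
  by rewrite (eq_gini_gamma (fun u v u01 v01 =>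
    B_lowerE ht (lower_is_copula hc) u01 v01)) gini_gamma_lower//; field.
by rewrite (eq_gini_gamma (fun u v u01 v01 =>
  B_upperE ht (upper_is_copula hc) u01 v01)) gini_gamma_upper//; field.
Qed.
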